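(* Fix $s\in[0,2)$. The unit speed magnetic geodesic flow on $(\mathbb S^3,g,s\,\mathrm d\alpha)$ covers all magnetic systems $(\mathbb S^2(\tfrac12),g,r\sigma)$, $r\in\mathbb R$; that is, for every $r\in\mathbb R$ there is $\psi\in(0,\pi)$ such that the unit speed magnetic geodesics of $(\mathbb S^2(\tfrac12),g,r\sigma)$ are exactly the orientation-preserving unit speed reparametrizations of the projections $\pi(\gamma)$ of the unit speed magnetic geodesics $\gamma$ of $(\mathbb S^3,g,s\,\mathrm d\alpha)$ with contact angle $\psi$.
   Context: $\mathbb S^3$ is the unit sphere in $\mathbb C^2$ with standard Hermitian product $\langle\cdot,\cdot\rangle$; on it $g=\mathrm{Re}\langle\cdot,\cdot\rangle$ and $\alpha_z=\tfrac12\mathrm{Re}\langle\mathrm iz,\cdot\rangle$. $\mathbb S^2(\tfrac12)\subset\mathbb R^3\equiv\mathbb C\times\mathbb R$ is the Euclidean sphere of radius $\tfrac12$ with its round metric, also denoted $g$, and area form $\sigma$; $\pi:\mathbb S^3\to\mathbb S^2(\tfrac12)$, $\pi(z_1,z_2)=\tfrac12(2\bar z_1z_2,|z_1|^2-|z_2|^2)$ is the Hopf map. (The statement does not depend on the orientation chosen for $\sigma$.) For a Riemannian manifold $(M,g)$ and closed two-form $\sigma$, the Lorentz force $Y$ is given by $g(Yu,v)=\sigma(u,v)$, and magnetic geodesics of $(M,g,\sigma)$ are curves $\gamma:\mathbb R\to M$ with $\nabla_{\dot\gamma}\dot\gamma=Y_\gamma\dot\gamma$. The contact angle of a unit speed magnetic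 geodesic $\gamma$ of $(\mathbb S^3,g,s\,\mathrm d\alpha)$ is the (constant) $\psi\in[0,\pi]$ with $\cos\psi=g_\gamma(\mathrm i\gamma,\dot\gamma)$. *)

(* Defs.v *)
From Stdlib Require Import Reals.
From Coquelicot Require Import Coquelicot.
Open Scope R_scope.

(** A magnetic system [(M, g, sigma)] on a round sphere
    [M = {x | <x, x> = radius^2}] of a Euclidean space [(ambient, inner)], where
    [g] is the restriction of [inner] to [M].  Only the values
    [mform x u v] at [x] in [M] and [u, v] tangent to [M] at [x] matter. *)
Record magnetic_system := MagneticSystem {
  ambient : NormedModule R_AbsRing;
  inner : ambient -> ambient -> R;
  radius : R;
  mform : ambient -> ambient -> ambient -> R
}.

Definition on_sphere (S : magnetic_system) (x : ambient S) : Prop :=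
  inner S x x = radius S ^ 2.

Definition tangent (S : magnetic_system) (x v : ambient S) : Prop :=
  inner S x v = 0.

Definition tangent_proj (S : magnetic_system) (x a : ambient S) : ambient S :=
  minus a (scal (inner S x a / inner S x x) x).

Definition is_lorentz_force (S : magnetic_system)
    (Y : ambient S -> ambient S -> ambient S) : Prop :=
  forall x u : ambient S, on_sphere S x -> tangent S x u ->
    tangent S x (Y x u) /\
    forall v : ambient S, tangent S x v -> inner S (Y x u) v = mform S x u v.

Definition is_velocity {V : NormedModule R_AbsRing} (c c' : R -> V) : Prop :=
  forall t : R, is_derive c t (c' t).

(** The Levi-Civita covariant derivative of the velocity of a curve in a
    submanifold of Euclidean space is the tangential part of its acceleration.
    Twice differentiable solutions of the equation are automatically smooth
    when [mform] is, so no further regularity is imposed. *)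
Definition magnetic_geodesic (S : magnetic_system) (c : R -> ambient S) : Prop :=
  (forall t : R, on_sphere S (c t)) /\
  exists (c' c'' : R -> ambient S) (Y : ambient S -> ambient S -> ambient S),
    is_velocity c c' /\ is_velocity c' c'' /\ is_lorentz_force S Y /\
    forall t : R, tangent_proj S (c t) (c'' t) = Y (c t) (c' t).

Definition unit_speed (S : magnetic_system) (c : R -> ambient S) : Prop :=
  exists c' : R -> ambient S,
    is_velocity c c' /\ forall t : R, inner S (c' t) (c' t) = 1.

(** A smooth [phi : R -> R] with positive derivative is an orientation-preserving
    diffeomorphism of [R] as soon as it is onto. *)
Definition op_reparametrization {V : Type} (c e : R -> V) : Prop :=
  exists phi : R -> R,
    (forall (n : nat) (t : R), ex_derive_n phi n t) /\
    (forall t : R, 0 < Derive phi t) /\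
    (forall y : R, exists t : R, phi t = y) /\
    forall t : R, e t = c (phi t).

(** The exterior derivative of a one-form on a vector space, evaluated on
    constant vector fields: [da_z(u, v) = D_u(a(v))(z) - D_v(a(u))(z)]. *)
Definition ext_deriv {V : NormedModule R_AbsRing} (a : V -> V -> R)
    (z u v : V) : R :=
  Derive (fun t : R => a (plus z (scal t u)) v) 0
  - Derive (fun t : R => a (plus z (scal t v)) u) 0.

Definition C2 : NormedModule R_AbsRing :=
  prod_NormedModule R_AbsRing C_R_NormedModule C_R_NormedModule.

Definition hermitian (z w : C * C) : C :=
  (fst z * Cconj (fst w) + snd z * Cconj (snd w))%C.

Definition mul_i (z : C * C) : C * C := ((Ci * fst z)%C, (Ci * snd z)%C).

Definition inner_C2 (z w : C2) : R := Re (hermitian z w).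

Definition alpha (z v : C2) : R := / 2 * Re (hermitian (mul_i z) v).

(** [(S^3, g, s d(alpha))]: [alpha] is given by the same formula on all of [C^2],
    and the exterior derivative commutes with restriction to [S^3]. *)
Definition S3_magnetic (s : R) : magnetic_system :=
  MagneticSystem C2 inner_C2 1 (fun z u v => s * ext_deriv alpha z u v).

Definition CxR : NormedModule R_AbsRing :=
  prod_NormedModule R_AbsRing C_R_NormedModule R_NormedModule.

Definition inner_CxR (x y : C * R) : R :=
  Re (fst x * Cconj (fst y))%C + snd x * snd y.

(** The determinant of three vectors of [R^3 = C x R]. *)
Definition det3 (x y z : C * R) : R :=
    Re (fst x) * (Im (fst y) * snd z - snd y * Im (fst z))
  - Im (fst x) * (Re (fst y) * snd z - snd y * Re (fst z))
  + snd x * (Re (fst y) * Im (fst z) - Im (fst y) * Re (fst z)).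

(** The area form of the sphere of radius 1/2, oriented by the outward unit
    normal [x / (1/2)]. *)
Definition area_form_S2 (x u v : CxR) : R :=
  det3 (scal (/ (1 / 2)) x : CxR) u v.

Definition S2_magnetic (r : R) : magnetic_system :=
  MagneticSystem CxR inner_CxR (1 / 2) (fun x u v => r * area_form_S2 x u v).

Definition hopf (z : C2) : CxR :=
  ((RtoC (/ 2) * (2 * Cconj (fst z) * snd z))%C,
   / 2 * (Cmod (fst z) ^ 2 - Cmod (snd z) ^ 2)).

Definition has_contact_angle (c : R -> C2) (psi : R) : Prop :=
  0 <= psi <= PI /\
  exists c' : R -> C2,
    is_velocity c c' /\ forall t : R, cos psi = inner_C2 (mul_i (c t)) (c' t).

(* Main.v *)
Require Import Defs.
From Stdlib Require Import Reals Lra.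
From Coquelicot Require Import Coquelicot.
Open Scope R_scope.
#[local] Set Bullet Behavior "Strict Subproofs".

(** Why the theorem holds.  On [S^3] the Lorentz force of [s d(alpha)] is
    [u |-> s (iu + <iz, u> z)], so a unit speed magnetic geodesic [gamma] with
    contact angle [psi] satisfies [gamma'' = s i gamma' + (s cos psi - 1) gamma].
    On [S^2(1/2)] the Lorentz force of [r sigma] is [u |-> 2r (x * u)], where [*]
    is the cross product, so a unit speed magnetic geodesic [eta] satisfies
    [eta'' = 2r (eta * eta') - 4 eta].  Both follow from one statement on
    magnetic systems on round spheres ([unit_speed_magnetic_geodesic_iff]).

    The Hopf map is quadratic, so its differential [dhopf z v] is bilinear and
    everything about it follows from polynomial identities: [norm_dhopf] says
    that it kills only the vertical direction [iz] and is isometric on the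
    complement, so [hopf o gamma] has speed [sin psi]; [dhopf_mul_i] and
    [dhopf_diagonal] compute the acceleration of [hopf o gamma].  Reparametrized
    to unit speed, the projection is a magnetic geodesic of strength
    [r = (s - 2 cos psi) / sin psi] ([hopf_motion]).  The numerator of this
    quotient is negative near [psi = 0] and positive near [psi = PI] because
    [0 <= s < 2], so every real [r] is attained ([contact_angle_exists]).

    A reparametrization with positive derivative that makes the projection unit
    speed must have derivative [1 / sin psi]
    ([unit_speed_reparametrization_rate]), so all the curves of the right-hand
    side are magnetic geodesics of [S^2(1/2)].  Conversely, a given [eta] shares
    its initial position and velocity with such a projection: a point and a
    velocity can be lifted to [S^3] with contact angle [psi]
    ([hopf_surjective], [contact_velocity_exists]), and there is a magnetic
    geodesic of [S^3], defined for all times, with the lifted initial data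
    ([S3_motion_exists]).  The two curves agree because initial data determine
    the solution ([S2_motion_unique]). *)

(** * Curves in products *)

Lemma is_derive_pair {U V : NormedModule R_AbsRing}
    (f : R -> U) (g : R -> V) (t : R) (u : U) (v : V) :
  is_derive f t u -> is_derive g t v ->
  is_derive (fun x => (f x, g x) : prod_NormedModule R_AbsRing U V) t (u, v).
Proof.
  intros Hf Hg.
  apply (filterdiff_comp_2 f g (fun a b => (a, b)) _ _ (fun a b => (a, b)) Hf Hg).
  apply filterdiff_ext with (f := fun p : prod_NormedModule R_AbsRing U V => p).
  - now intros [a b].
  - apply filterdiff_ext_lin with (l1 := fun p : prod_NormedModule R_AbsRing U V => p).
    + apply filterdiff_id.
    + now intros [a b].
Qed.

Lemma is_derive_prod {U V : NormedModule R_AbsRing}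
    (f : R -> prod_NormedModule R_AbsRing U V) (t : R)
    (l : prod_NormedModule R_AbsRing U V) :
  is_derive f t l <->
  is_derive (fun x => fst (f x)) t (fst l) /\ is_derive (fun x => snd (f x)) t (snd l).
Proof.
  split.
  - intros H; split.
    + exact (filterdiff_comp f fst _ fst H (filterdiff_linear _ is_linear_fst)).
    + exact (filterdiff_comp f snd _ snd H (filterdiff_linear _ is_linear_snd)).
  - intros [H1 H2].
    apply is_derive_ext with (f := fun x => (fst (f x), snd (f x))).
    + intros x; now destruct (f x).
    + destruct l; now apply is_derive_pair.
Qed.

Lemma is_derive_C2 (f : R -> C * C) (t : R) (l : C * C) :
  is_derive (f : R -> C2) t l <->
  (is_derive (fun x => fst (fst (f x))) t (fst (fst l)) /\
   is_derive (fun x => snd (fst (f x))) t (snd (fst l))) /\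
  (is_derive (fun x => fst (snd (f x))) t (fst (snd l)) /\
   is_derive (fun x => snd (snd (f x))) t (snd (snd l))).
Proof.
  unfold C2; rewrite is_derive_prod.
  now rewrite (is_derive_prod (U := R_NormedModule) (V := R_NormedModule) (fun x => fst (f x))),
   (is_derive_prod (U := R_NormedModule) (V := R_NormedModule) (fun x => snd (f x))).
Qed.

Lemma is_derive_CxR (f : R -> C * R) (t : R) (l : C * R) :
  is_derive (f : R -> CxR) t l <->
  (is_derive (fun x => fst (fst (f x))) t (fst (fst l)) /\
   is_derive (fun x => snd (fst (f x))) t (snd (fst l))) /\
  is_derive (fun x => snd (f x)) t (snd l).
Proof.
  unfold CxR; rewrite is_derive_prod.
  now rewrite (is_derive_prod (U := R_NormedModule) (V := R_NormedModule) (fun x => fst (f x))).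
Qed.

Lemma is_derive_Rmult (f g : R -> R) (t a b : R) :
  is_derive f t a -> is_derive g t b ->
  is_derive (fun x => f x * g x) t (a * g t + f t * b).
Proof. intros; apply (is_derive_mult f g); auto; exact Rmult_comm. Qed.

Lemma is_derive_Rplus (f g : R -> R) (t a b : R) :
  is_derive f t a -> is_derive g t b -> is_derive (fun x => f x + g x) t (a + b).
Proof. exact (is_derive_plus f g t a b). Qed.

Lemma is_derive_Rminus (f g : R -> R) (t a b : R) :
  is_derive f t a -> is_derive g t b -> is_derive (fun x => f x - g x) t (a - b).
Proof. exact (is_derive_minus f g t a b). Qed.

Lemma is_derive_Ropp (f : R -> R) (t a : R) :
  is_derive f t a -> is_derive (fun x => - f x) t (- a).
Proof. exact (is_derive_opp f t a). Qed.

Lemma is_derive_Rconst (a t : R) : is_derive (fun _ => a) t 0.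
Proof. exact (is_derive_const a t). Qed.

Lemma is_derive_scal_vector {V : NormedModule R_AbsRing} (f : R -> V) (t k : R) (l : V) :
  is_derive f t l -> is_derive (fun x => scal k (f x)) t (scal k l).
Proof.
  intros H.
  apply filterdiff_ext_lin with (l1 := fun y : R => scal k (scal y l)).
  - apply (filterdiff_scal_r_fct (K := R_AbsRing) k f (fun y => scal y l)); trivial.
    exact Rmult_comm.
  - intros y; rewrite !scal_assoc; f_equal; apply Rmult_comm.
Qed.

Lemma is_derive_same (f : R -> R) (t a b : R) :
  is_derive f t a -> is_derive f t b -> a = b.
Proof. intros Ha Hb; now rewrite <- (is_derive_unique _ _ _ Ha), (is_derive_unique _ _ _ Hb). Qed.

Lemma derivative_of_constant (f : R -> R) (t k a : R) :
  (forall x, f x = k) -> is_derive f t a -> a = 0.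
Proof.
  intros H Ha; apply (is_derive_same f t); trivial.
  apply is_derive_ext with (f := fun _ => k); auto using is_derive_Rconst.
Qed.

Lemma zero_derivative_constant (f : R -> R) :
  (forall t, is_derive f t 0) -> forall x y, f x = f y.
Proof.
  intros H x y.
  destruct (Rtotal_order x y) as [h | [-> | h]]; trivial.
  - now apply (eq_is_derive (V := R_NormedModule)).
  - symmetry; now apply (eq_is_derive (V := R_NormedModule)).
Qed.

(** The rule is chosen by the syntax of the function: applying the rules
    blindly unfolds the vector space structures and diverges. *)
Ltac derive_real :=
  evar_last;
  [ repeat match goal with
    | H : is_derive ?h ?t _ |- is_derive ?h ?t _ => exact H
    | |- is_derive (fun x => _ + _) _ _ => apply is_derive_Rplus
    | |- is_derive (fun x => _ - _) _ _ => apply is_derive_Rminus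
    | |- is_derive (fun x => - _) _ _ => apply is_derive_Ropp
    | |- is_derive (fun x => _ * _) _ _ => apply is_derive_Rmult
    | |- is_derive (fun x => ?a) _ _ => apply is_derive_Rconst
    end
  | ].

(** * Magnetic geodesics of round spheres *)

Lemma minus_plus_cancel {G : AbelianGroup} (x y : G) : plus (minus x y) y = x.
Proof. unfold minus; now rewrite <- plus_assoc, plus_opp_l, plus_zero_r. Qed.

Lemma plus_minus_cancel {G : AbelianGroup} (x y : G) : minus (plus x y) y = x.
Proof.
  transitivity (plus x (plus y (opp y))).
  - symmetry; apply plus_assoc.
  - transitivity (plus x zero); [f_equal; apply plus_opp_r | apply plus_zero_r].
Qed.

(** What the theory below uses of the Euclidean space that contains the sphere;
    the last field ties the topology of the normed module to the inner product. *)
Record euclidean (S : magnetic_system) : Prop := {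
  inner_sym : forall x y, inner S x y = inner S y x;
  inner_plus : forall x y z, inner S (plus x y) z = inner S x z + inner S y z;
  inner_scal : forall k x z, inner S (scal k x) z = k * inner S x z;
  inner_nonneg : forall x, 0 <= inner S x x;
  inner_definite : forall x, inner S x x = 0 -> x = zero;
  inner_derive : forall (f g : R -> ambient S) t u v,
    is_derive f t u -> is_derive g t v ->
    is_derive (fun x => inner S (f x) (g x)) t (inner S u (g t) + inner S (f t) v)
}.

Lemma magnetic_geodesic_ext (S : magnetic_system) (c e : R -> ambient S) :
  (forall t, c t = e t) -> magnetic_geodesic S c -> magnetic_geodesic S e.
Proof.
  intros E [Hs (c' & c'' & Y & Hc & Hc' & HY & A)]; split.
  - intros t; rewrite <- E; apply Hs.
  - exists c', c'', Y; refine (conj _ (conj Hc' (conj HY _))); intros t.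
    + now apply is_derive_ext with (f := c).
    + rewrite <- E; apply A.
Qed.

Section Euclidean.

Context {S : magnetic_system} (HS : euclidean S).

Lemma inner_minus x y z : inner S (minus x y) z = inner S x z - inner S y z.
Proof.
  replace (minus x y) with (plus x (scal (-1) y))
    by (unfold minus; f_equal; exact (scal_opp_one (K := R_AbsRing) y)).
  rewrite (inner_plus _ HS), (inner_scal _ HS); ring.
Qed.

Lemma inner_minus_r x y z : inner S x (minus y z) = inner S x y - inner S x z.
Proof. rewrite (inner_sym _ HS), inner_minus, !(inner_sym _ HS _ x); ring. Qed.

Lemma inner_minus_definite x y : inner S (minus x y) (minus x y) = 0 -> x = y.
Proof.
  intros H; apply (inner_definite _ HS) in H.
  transitivity (plus (minus x y) y).
  - symmetry; exact (minus_plus_cancel _ _).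
  - rewrite H; apply plus_zero_l.
Qed.

(** Derivatives in a normed module are compared through their inner products
    with the fixed vector [c1 t - c2 t], where uniqueness for real functions
    applies. *)
Lemma velocity_unique (c c1 c2 : R -> ambient S) :
  is_velocity c c1 -> is_velocity c c2 -> forall t, c1 t = c2 t.
Proof.
  intros H1 H2 t; apply inner_minus_definite.
  rewrite inner_minus.
  set (w := minus (c1 t) (c2 t)).
  assert (Hw : is_derive (fun _ : R => w) t zero) by apply (is_derive_const w t).
  pose proof (is_derive_same _ _ _ _ (inner_derive _ HS c _ t _ _ (H1 t) Hw)
                (inner_derive _ HS c _ t _ _ (H2 t) Hw)); lra.
Qed.

(** The difference of two Lorentz forces is itself a tangent vector, hence
    orthogonal to itself. *)
Lemma lorentz_force_unique Y Y' x u :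
  is_lorentz_force S Y -> is_lorentz_force S Y' ->
  on_sphere S x -> tangent S x u -> Y x u = Y' x u.
Proof.
  intros H H' Hx Hu.
  destruct (H x u Hx Hu) as [T E], (H' x u Hx Hu) as [T' E'].
  assert (Tv : tangent S x (minus (Y x u) (Y' x u)))
    by (unfold tangent in *; rewrite inner_minus_r; lra).
  apply inner_minus_definite.
  rewrite inner_minus, (E _ Tv), (E' _ Tv); ring.
Qed.

(** Magnetic geodesics parametrized by arc length, as solutions of an ordinary
    differential equation in the ambient space: the normal part of the
    acceleration is [- c / radius^2] because [<c, c''> = - <c', c'> = -1]. *)
Definition magnetic_motion (F : ambient S -> ambient S -> ambient S)
    (c c' c'' : R -> ambient S) : Prop :=
  is_velocity c c' /\ is_velocity c' c'' /\
  (forall t, on_sphere S (c t)) /\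
  (forall t, inner S (c' t) (c' t) = 1) /\
  forall t, c'' t = minus (F (c t) (c' t)) (scal (/ radius S ^ 2) (c t)).

Lemma sphere_velocity_tangent (c c' : R -> ambient S) :
  is_velocity c c' -> (forall t, on_sphere S (c t)) -> forall t, tangent S (c t) (c' t).
Proof.
  intros Hc Hs t; unfold tangent.
  pose proof (derivative_of_constant _ t _ _ Hs
                (inner_derive _ HS c c t _ _ (Hc t) (Hc t))) as E.
  rewrite (inner_sym _ HS (c' t)) in E; lra.
Qed.

Lemma sphere_acceleration_normal (c c' c'' : R -> ambient S) :
  is_velocity c c' -> is_velocity c' c'' -> (forall t, on_sphere S (c t)) ->
  forall t, inner S (c t) (c'' t) = - inner S (c' t) (c' t).
Proof.
  intros Hc Hc' Hs t.
  pose proof (derivative_of_constant _ t _ _ (sphere_velocity_tangent c c' Hc Hs)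
                (inner_derive _ HS c c' t _ _ (Hc t) (Hc' t))); lra.
Qed.

(** Reduces geodesics, whose definition quantifies over Lorentz forces and
    covariant derivatives, to the equation for one explicit force [F]. *)
Lemma unit_speed_magnetic_geodesic_iff F (c : R -> ambient S) :
  radius S <> 0 -> is_lorentz_force S F ->
  (magnetic_geodesic S c /\ unit_speed S c) <->
  exists c' c'', magnetic_motion F c c' c''.
Proof.
  intros Hr HF.
  assert (Proj : forall c' c'' : R -> ambient S,
    is_velocity c c' -> is_velocity c' c'' -> (forall t, on_sphere S (c t)) ->
    (forall t, inner S (c' t) (c' t) = 1) -> forall t,
    tangent_proj S (c t) (c'' t) = plus (c'' t) (scal (/ radius S ^ 2) (c t))).
  { intros c' c'' Hc Hc' Hs Hu t; unfold tangent_proj, minus.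
    rewrite (sphere_acceleration_normal c c' c'' Hc Hc' Hs t), Hu, (Hs t).
    f_equal; etransitivity; [symmetry; exact (scal_opp_l (K := R_AbsRing) _ _) |].
    f_equal; unfold opp; simpl; field; trivial. }
  split.
  - intros [[Hs (c' & c'' & Y & Hc & Hc' & HY & E)] (u & Hu & N)].
    assert (N' : forall t, inner S (c' t) (c' t) = 1).
    { intros t; rewrite <- (velocity_unique c u c' Hu Hc t); trivial. }
    exists c', c''; refine (conj Hc (conj Hc' (conj Hs (conj N' _)))); intros t.
    rewrite (lorentz_force_unique F Y _ _ HF HY (Hs t)
               (sphere_velocity_tangent c c' Hc Hs t)), <- E.
    rewrite (Proj c' c'') by trivial.
    symmetry; exact (plus_minus_cancel _ _).
  - intros (c' & c'' & Hc & Hc' & Hs & N & E); split.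
    + split; trivial; exists c', c'', F.
      refine (conj Hc (conj Hc' (conj HF _))); intros t.
      rewrite (Proj c' c'') by trivial; rewrite E.
      exact (minus_plus_cancel _ _).
    + now exists c'.
Qed.

End Euclidean.

(** * The two spheres *)

(** Vector identities are checked on real coordinates. *)
Ltac coords :=
  repeat match goal with
  | z : NormedModule.sort _ (ambient _) |- _ => progress simpl in z
  | z : NormedModule.sort _ C2 |- _ => destruct z as [[? ?] [? ?]]
  | x : NormedModule.sort _ CxR |- _ => destruct x as [[? ?] ?]
  end;
  unfold inner_C2, inner_CxR, hermitian, mul_i, minus, plus, opp, scal; simpl;
  unfold plus, opp, scal, zero, mult; simpl; unfold zero, mult; simpl.

Ltac coords_eq :=
  intros; coords; repeat apply injective_projections; simpl;
  unfold plus, opp, scal, zero, mult; simpl; unfold zero, mult; simpl;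
  match goal with |- ?a = ?b => change (@eq R a b) end; try ring.

Lemma inner_C2_derive (f g : R -> C2) (t : R) (u v : C2) :
  is_derive f t u -> is_derive g t v ->
  is_derive (fun x => inner_C2 (f x) (g x)) t (inner_C2 u (g t) + inner_C2 (f t) v).
Proof.
  rewrite !is_derive_C2; intros ((? & ?) & (? & ?)) ((? & ?) & (? & ?)).
  unfold inner_C2, hermitian; simpl; derive_real; simpl; ring.
Qed.

Lemma inner_CxR_derive (f g : R -> CxR) (t : R) (u v : CxR) :
  is_derive f t u -> is_derive g t v ->
  is_derive (fun x => inner_CxR (f x) (g x)) t (inner_CxR u (g t) + inner_CxR (f t) v).
Proof.
  rewrite !is_derive_CxR; intros ((? & ?) & ?) ((? & ?) & ?).
  unfold inner_CxR; simpl; derive_real; simpl; ring.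
Qed.

Lemma euclidean_S3 (s : R) : euclidean (S3_magnetic s).
Proof.
  constructor; simpl; intros; try (coords; ring).
  - coords; nra.
  - destruct x as [[a b] [c d]].
    unfold inner_C2, hermitian in H; simpl in H.
    assert (a = 0) by nra; assert (b = 0) by nra.
    assert (c = 0) by nra; assert (d = 0) by nra; now subst.
  - now apply inner_C2_derive.
Qed.

Lemma euclidean_S2 (r : R) : euclidean (S2_magnetic r).
Proof.
  constructor; simpl; intros; try (coords; ring).
  - coords; nra.
  - destruct x as [[a b] c].
    unfold inner_CxR in H; simpl in H.
    assert (a = 0) by nra; assert (b = 0) by nra; assert (c = 0) by nra; now subst.
  - now apply inner_CxR_derive.
Qed.

Definition cross (x y : CxR) : CxR :=
  ((Im (fst x) * snd y - snd x * Im (fst y), snd x * Re (fst y) - Re (fst x) * snd y),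
   Re (fst x) * Im (fst y) - Im (fst x) * Re (fst y)).

(** [s iu] made tangent: its component along [z] is [- s <iz, u>]. *)
Definition lorentz_S3 (s : R) (z u : C2) : C2 :=
  scal s (plus (mul_i u : C2) (scal (inner_C2 (mul_i z) u) z)).

Definition lorentz_S2 (r : R) (x u : CxR) : CxR := scal (2 * r) (cross x u).

(** [alpha] is linear in the base point, so its directional derivatives are
    its values, and the two terms of [ext_deriv] agree by antisymmetry of
    [(u, v) |-> <iu, v>]. *)
Lemma ext_deriv_alpha (z u v : C2) : ext_deriv alpha z u v = inner_C2 (mul_i u) v.
Proof.
  assert (D : forall a b : C2,
    Derive (fun t : R => alpha (plus z (scal t a)) b) 0 = / 2 * inner_C2 (mul_i a) b).
  { intros a b; apply is_derive_unique.
    apply is_derive_ext with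
      (f := fun t => / 2 * inner_C2 (mul_i z) b + t * (/ 2 * inner_C2 (mul_i a) b)).
    - intros t; unfold alpha; fold (inner_C2 (mul_i (plus z (scal t a))) b); coords; ring.
    - auto_derive; trivial; ring. }
  unfold ext_deriv; rewrite !D; coords; field.
Qed.

Lemma lorentz_force_S3 (s : R) : is_lorentz_force (S3_magnetic s) (lorentz_S3 s).
Proof.
  intros z u Hz Hu; unfold on_sphere, tangent in *; simpl in *; split.
  - unfold lorentz_S3.
    transitivity (s * inner_C2 (mul_i z) u * (inner_C2 z z - 1)).
    + coords; ring.
    + rewrite Hz; ring.
  - intros v Hv; rewrite ext_deriv_alpha.
    transitivity (s * inner_C2 (mul_i u) v + s * inner_C2 (mul_i z) u * inner_C2 z v).
    + unfold lorentz_S3; coords; ring.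
    + rewrite Hv; ring.
Qed.

Lemma lorentz_force_S2 (r : R) : is_lorentz_force (S2_magnetic r) (lorentz_S2 r).
Proof.
  intros x u _ _; unfold tangent; simpl; split; intros;
    unfold lorentz_S2, cross, area_form_S2, det3; coords; unfold Re, Im; simpl; field.
Qed.

(** * The Hopf map as a quadratic map *)

(** The symmetric bilinear map whose quadratic map is [2 hopf]; hence
    [dhopf z] is the differential of [hopf] at [z]. *)
Definition dhopf (z v : C2) : CxR :=
  ((Cconj (fst v) * snd z + Cconj (fst z) * snd v)%C,
   Re (fst z * Cconj (fst v))%C - Re (snd z * Cconj (snd v))%C).

(** The transpose of [dhopf z] ([dhopf_adjointP]).  Its values are orthogonal to
    the kernel of [dhopf z], so for unit [z] it is the horizontal lift of
    tangent vectors of the two-sphere. *)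
Definition dhopf_adjoint (z : C2) (u : CxR) : C2 :=
  ((snd z * Cconj (fst u) + RtoC (snd u) * fst z)%C,
   (fst z * fst u - RtoC (snd u) * snd z)%C).

Ltac hopf_coords :=
  intros; unfold lorentz_S2, cross, dhopf, dhopf_adjoint; coords_eq.

Lemma hopf_dhopf z : hopf z = scal (/ 2) (dhopf z z).
Proof.
  destruct z as [[a b] [c d]]; unfold hopf, Cmod; simpl fst; simpl snd.
  rewrite !pow2_sqrt by nra.
  unfold dhopf, scal; simpl.
  repeat apply injective_projections; simpl; unfold scal; simpl; unfold mult; simpl; field.
Qed.

Lemma dhopf_derive (f g : R -> C2) (t : R) (u v : C2) :
  is_derive f t u -> is_derive g t v ->
  is_derive (fun x => dhopf (f x) (g x)) t (plus (dhopf u (g t)) (dhopf (f t) v)).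
Proof.
  rewrite !is_derive_C2, is_derive_CxR; intros ((? & ?) & (? & ?)) ((? & ?) & (? & ?)).
  unfold dhopf; simpl; (split; [split |]); derive_real; simpl; unfold plus; simpl; ring.
Qed.

Lemma hopf_derive (f : R -> C2) (t : R) (u : C2) :
  is_derive f t u -> is_derive (fun x => hopf (f x)) t (dhopf (f t) u).
Proof.
  intros H.
  apply is_derive_ext with (f := fun x => scal (/ 2) (dhopf (f x) (f x))).
  - intros x; now rewrite hopf_dhopf.
  - evar_last.
    + apply is_derive_scal_vector, dhopf_derive; eassumption.
    + generalize (f t); hopf_coords; field.
Qed.

Lemma norm_dhopf z v :
  inner_CxR (dhopf z v) (dhopf z v) =
  inner_C2 z z * inner_C2 v v - inner_C2 (mul_i z) v ^ 2.
Proof. hopf_coords. Qed.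

Lemma norm_hopf z : inner_CxR (hopf z) (hopf z) = (inner_C2 z z / 2) ^ 2.
Proof. rewrite hopf_dhopf; unfold dhopf; coords_eq; field. Qed.

(** On horizontal vectors, [dhopf z] carries multiplication by [i] to the
    rotation [x |-> 2 hopf(z) * x] of the tangent plane, which is why the
    Lorentz force of [S^3] projects to one of [S^2(1/2)].  The last term accounts
    for the vertical part of [v], as [dhopf z (i (iz)) = - dhopf z z].  Factors
    [<z, z>] make the identity homogeneous, hence valid for all [z] and [v]. *)
Lemma dhopf_mul_i z v :
  scal (inner_C2 z z) (dhopf z (mul_i v)) =
  minus (cross (dhopf z z) (dhopf z v)) (scal (inner_C2 (mul_i z) v) (dhopf z z)).
Proof. hopf_coords. Qed.

(** The second order term of the acceleration of a projected curve.  The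
    coefficient of [dhopf z (iv)] produces the [- 2 cos psi] in the strength of
    the projected magnetic field: it is present even for great circles. *)
Lemma dhopf_diagonal z v :
  scal (inner_C2 z z) (dhopf v v) =
  minus (scal (2 * inner_C2 z v) (dhopf z v))
    (plus (scal (2 * inner_C2 (mul_i z) v) (dhopf z (mul_i v)))
          (scal (inner_C2 v v) (dhopf z z))).
Proof. hopf_coords. Qed.

Lemma dhopf_dhopf_adjoint z u :
  dhopf z (dhopf_adjoint z u) = scal (inner_C2 z z) u.
Proof. hopf_coords. Qed.

Lemma dhopf_adjointP z u v :
  inner_C2 (dhopf_adjoint z u) v = inner_CxR u (dhopf z v).
Proof. hopf_coords. Qed.

Lemma dhopf_adjoint_norm z u :
  inner_C2 (dhopf_adjoint z u) (dhopf_adjoint z u) = inner_C2 z z * inner_CxR u u.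
Proof. hopf_coords. Qed.

(** * Uniqueness of magnetic geodesics on the two-sphere *)

Lemma cross_derive (f g : R -> CxR) (t : R) (u v : CxR) :
  is_derive f t u -> is_derive g t v ->
  is_derive (fun x => cross (f x) (g x)) t (plus (cross u (g t)) (cross (f t) v)).
Proof.
  rewrite !is_derive_CxR; intros ((? & ?) & ?) ((? & ?) & ?).
  unfold cross, Re, Im; simpl; (split; [split |]); derive_real; simpl; unfold plus; simpl; ring.
Qed.

Lemma cross_lorentz_S2 r x u :
  cross x (minus (lorentz_S2 r x u) (scal 4 x)) =
  scal (2 * r) (minus (scal (inner_CxR x u) x) (scal (inner_CxR x x) u)).
Proof. unfold lorentz_S2, cross; coords_eq. Qed.

Lemma S2_motion_acceleration r eta eta' eta'' :
  magnetic_motion (S := S2_magnetic r) (lorentz_S2 r) eta eta' eta'' ->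
  forall t, eta'' t = minus (lorentz_S2 r (eta t) (eta' t)) (scal 4 (eta t)).
Proof.
  intros (_ & _ & _ & _ & E) t; rewrite E; simpl; f_equal; f_equal; field.
Qed.

(** With the unit normal [n = 2 (eta * eta')], the frame [(eta, eta', n)] of a
    motion satisfies the linear system [eta'' = r n - 4 eta], [n' = - r eta']
    with constant coefficients. *)
Lemma S2_motion_frame r eta eta' eta'' :
  magnetic_motion (S := S2_magnetic r) (lorentz_S2 r) eta eta' eta'' ->
  forall t, is_derive (fun x => scal 2 (cross (eta x) (eta' x))) t (scal (- r) (eta' t)).
Proof.
  intros H t; pose proof (S2_motion_acceleration _ _ _ _ H t) as A.
  destruct H as (V & V' & Hs & _ & _).
  evar_last.
  - apply is_derive_scal_vector, cross_derive; [apply V | apply V'].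
  - rewrite A.
    pose proof (sphere_velocity_tangent (euclidean_S2 r) eta eta' V Hs t) as T.
    specialize (Hs t); unfold tangent, on_sphere in *; simpl in *.
    rewrite cross_lorentz_S2, T, Hs.
    generalize (eta t) (eta' t); unfold cross; coords_eq; field.
Qed.

(** The differences [d], [T], [N] of the frames of two motions solve
    [d' = T], [T' = r N - 4 d], [N' = - r T], for which
    [4 |d|^2 + |T|^2 + |N|^2] is conserved; it vanishes at time [0]. *)
Lemma S2_motion_unique r eta eta' eta'' zeta zeta' zeta'' :
  magnetic_motion (S := S2_magnetic r) (lorentz_S2 r) eta eta' eta'' ->
  magnetic_motion (S := S2_magnetic r) (lorentz_S2 r) zeta zeta' zeta'' ->
  eta 0 = zeta 0 -> eta' 0 = zeta' 0 -> forall t, eta t = zeta t.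
Proof.
  intros H K E0 E1 t.
  set (d := fun t => minus (eta t) (zeta t) : CxR).
  set (T := fun t => minus (eta' t) (zeta' t) : CxR).
  set (N := fun t => minus (scal 2 (cross (eta t) (eta' t)))
                           (scal 2 (cross (zeta t) (zeta' t))) : CxR).
  assert (Dd : forall t, is_derive d t (T t)).
  { intros x; apply (is_derive_minus (V := CxR)); [apply H | apply K]. }
  assert (DT : forall t, is_derive T t (minus (scal r (N t)) (scal 4 (d t)))).
  { intros x; evar_last.
    - apply (is_derive_minus (V := CxR)); [apply H | apply K].
    - rewrite (S2_motion_acceleration _ _ _ _ H), (S2_motion_acceleration _ _ _ _ K).
      unfold N, d; generalize (eta x) (eta' x) (zeta x) (zeta' x).
      intros; unfold lorentz_S2, cross; coords_eq. }
  assert (DN : forall t, is_derive N t (scal (- r) (T t))).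
  { intros x; evar_last.
    - apply (is_derive_minus (V := CxR));
        [apply (S2_motion_frame _ _ _ _ H) | apply (S2_motion_frame _ _ _ _ K)].
    - unfold T; generalize (eta' x) (zeta' x); intros; coords_eq. }
  assert (C : forall x, is_derive (fun t => 4 * inner_CxR (d t) (d t)
              + inner_CxR (T t) (T t) + inner_CxR (N t) (N t)) x 0).
  { intros x.
    pose proof (inner_CxR_derive _ _ _ _ _ (Dd x) (Dd x)).
    pose proof (inner_CxR_derive _ _ _ _ _ (DT x) (DT x)).
    pose proof (inner_CxR_derive _ _ _ _ _ (DN x) (DN x)).
    derive_real; generalize (d x) (T x) (N x); intros; coords; ring. }
  pose proof (zero_derivative_constant _ C t 0) as E; simpl in E.
  assert (Z : 4 * inner_CxR (d 0) (d 0) + inner_CxR (T 0) (T 0) + inner_CxR (N 0) (N 0) = 0).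
  { unfold d, T, N; rewrite E0, E1; generalize (zeta 0) (zeta' 0); intros; coords; ring. }
  pose proof (inner_nonneg _ (euclidean_S2 r) (d t)).
  pose proof (inner_nonneg _ (euclidean_S2 r) (T t)).
  pose proof (inner_nonneg _ (euclidean_S2 r) (N t)).
  simpl in *.
  apply (inner_minus_definite (euclidean_S2 r)); simpl; fold (d t); lra.
Qed.

(** * Projecting magnetic geodesics *)

Lemma is_derive_comp_constant_rate {V : NormedModule R_AbsRing}
    (f : R -> V) (phi : R -> R) (t k : R) (l : V) :
  is_derive f (phi t) l -> is_derive phi t k ->
  is_derive (fun x => f (phi x)) t (scal k l).
Proof. exact (is_derive_comp f phi t l k). Qed.

(** Here [c] is the cosine of the contact angle and [k] is the inverse of its
    sine.  With [z = gamma], [v = gamma'], the second derivative of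
    [hopf o gamma] is [dhopf v v + dhopf z gamma''], and substituting
    [gamma'' = s iv + (s c - 1) z] leaves
    [(s - 2 c) (dhopf z z * dhopf z v) - 2 (1 - c^2) dhopf z z]. *)
Lemma hopf_motion (s r c k : R) gamma gamma' gamma'' (phi : R -> R) :
  magnetic_motion (S := S3_magnetic s) (lorentz_S3 s) gamma gamma' gamma'' ->
  (forall t, inner_C2 (mul_i (gamma t)) (gamma' t) = c) ->
  k ^ 2 * (1 - c ^ 2) = 1 -> r = k * (s - 2 * c) ->
  (forall t, is_derive phi t k) ->
  exists eta'',
  magnetic_motion (S := S2_magnetic r) (lorentz_S2 r)
    (fun t => hopf (gamma (phi t)))
    (fun t => scal k (dhopf (gamma (phi t)) (gamma' (phi t)))) eta''.
Proof.
  intros (V & V' & Hs & Hu & A) Hc Hk Hr Hphi.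
  exists (fun t => scal k (scal k (plus
     (dhopf (gamma' (phi t)) (gamma' (phi t))) (dhopf (gamma (phi t)) (gamma'' (phi t)))))).
  assert (V1 : is_velocity (fun t => hopf (gamma (phi t)))
             (fun t => scal k (dhopf (gamma (phi t)) (gamma' (phi t))))).
  { intros t; apply (is_derive_comp_constant_rate (fun x => hopf (gamma x))); trivial.
    apply hopf_derive, V. }
  refine (conj V1 (conj _ (conj _ (conj _ _)))); intros t.
  - apply is_derive_scal_vector.
    apply (is_derive_comp_constant_rate (fun x => dhopf (gamma x) (gamma' x))); trivial.
    apply dhopf_derive; [apply V | apply V'].
  - unfold on_sphere; simpl.
    specialize (Hs (phi t)); unfold on_sphere in Hs; cbn [inner radius S3_magnetic] in Hs.
    rewrite norm_hopf, Hs; field.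
  - specialize (Hs (phi t)); specialize (Hu (phi t)); specialize (Hc (phi t)).
    unfold on_sphere in Hs; cbn [inner radius S3_magnetic S2_magnetic] in *.
    transitivity (k ^ 2 * inner_CxR (dhopf (gamma (phi t)) (gamma' (phi t)))
                    (dhopf (gamma (phi t)) (gamma' (phi t)))).
    + generalize (dhopf (gamma (phi t)) (gamma' (phi t))); intros; coords; ring.
    + rewrite norm_dhopf, Hs, Hu, Hc; etransitivity; [| exact Hk]; ring.
  - specialize (A (phi t)); specialize (Hc (phi t)).
    pose proof (sphere_velocity_tangent (euclidean_S3 s) _ _ V Hs (phi t)) as Ht.
    specialize (Hs (phi t)); specialize (Hu (phi t)).
    unfold on_sphere, tangent in *; cbn [inner radius S3_magnetic S2_magnetic] in *.
    revert A Hc Ht Hs Hu; generalize (gamma (phi t)) (gamma' (phi t)) (gamma'' (phi t)).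
    intros z v a A Hc Ht Hs Hu.
    pose proof (dhopf_mul_i z v) as I1; pose proof (dhopf_diagonal z v) as I2.
    rewrite Hs, Hc in I1; rewrite Hs, Hc, Ht, Hu in I2.
    assert (I3 : dhopf z a =
                 plus (scal s (dhopf z (mul_i v))) (scal (s * c - 1) (dhopf z z))).
    { rewrite A; unfold lorentz_S3; rewrite Hc; clear; hopf_coords; field. }
    assert (scal_one' : forall x : CxR, scal (1 ^ 2) x = x) by (intros; coords_eq).
    rewrite scal_one' in I1, I2; rewrite I3, I2, I1, hopf_dhopf.
    clear - Hk Hr; generalize (dhopf z z) (dhopf z v); intros p q; subst r.
    (* Isolating [k ^ 2 * (1 - c ^ 2)], which is 1, makes the rest an identity. *)
    transitivity (minus (scal (k * (k * (s - 2 * c))) (cross p q))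
                        (scal (2 * (k ^ 2 * (1 - c ^ 2))) p)).
    + generalize (cross p q); clear; intros; coords_eq.
    + rewrite Hk; clear; unfold lorentz_S2, cross; coords_eq; field.
Qed.

(** * Magnetic geodesics of the three-sphere *)

(** The flow [z |-> e^(i theta) z] of the Hopf fibration. *)
Definition rotate (theta : R) (z : C2) : C2 :=
  plus (scal (cos theta) z) (scal (sin theta) (mul_i z : C2)).

Lemma rotate_0 z : rotate 0 z = z.
Proof. unfold rotate; rewrite cos_0, sin_0; coords_eq. Qed.

Lemma inner_rotate theta z w : inner_C2 (rotate theta z) (rotate theta w) = inner_C2 z w.
Proof.
  transitivity ((Rsqr (sin theta) + Rsqr (cos theta)) * inner_C2 z w).
  - unfold rotate, Rsqr; coords; ring.
  - rewrite sin2_cos2; ring.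
Qed.

Lemma mul_i_rotate theta z : mul_i (rotate theta z) = rotate theta (mul_i z).
Proof. unfold rotate; coords_eq. Qed.

Lemma is_derive_cos_linear (k t : R) : is_derive (fun x => cos (k * x)) t (- k * sin (k * t)).
Proof. auto_derive; trivial; ring. Qed.

Lemma is_derive_sin_linear (k t : R) : is_derive (fun x => sin (k * x)) t (k * cos (k * t)).
Proof. auto_derive; trivial; ring. Qed.

Lemma rotate_derive (k : R) (f : R -> C2) (t : R) (u : C2) :
  is_derive f t u ->
  is_derive (fun x => rotate (k * x) (f x)) t
    (rotate (k * t) (plus u (scal k (mul_i (f t) : C2)))).
Proof.
  pose proof (is_derive_cos_linear k t); pose proof (is_derive_sin_linear k t).
  rewrite !is_derive_C2; intros ((? & ?) & (? & ?)).
  unfold rotate; simpl; unfold plus, scal; simpl; unfold plus, scal, mult; simpl.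
  unfold mult; simpl.
  (split; split); derive_real; simpl; unfold plus, scal; simpl; unfold mult; simpl; ring.
Qed.

Lemma mul_i_derive (f : R -> C2) (t : R) (u : C2) :
  is_derive f t u -> is_derive (fun x => mul_i (f x) : C2) t (mul_i u).
Proof.
  rewrite !is_derive_C2; intros ((? & ?) & (? & ?)); unfold mul_i; simpl.
  (split; split); derive_real; simpl; ring.
Qed.

Definition circle (omega : R) (z w : C2) (t : R) : C2 :=
  plus (scal (cos (omega * t)) z) (scal (sin (omega * t)) w).

(** The velocity of a great circle runs along another one, so that
    [circle_derive] also yields the acceleration. *)
Definition circle_velocity (omega : R) (z w : C2) (t : R) : C2 :=
  scal omega (circle omega w (opp z) t).

Lemma circle_derive omega z w : is_velocity (circle omega z w) (circle_velocity omega z w).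
Proof.
  intros t.
  pose proof (is_derive_cos_linear omega t); pose proof (is_derive_sin_linear omega t).
  destruct z as [[? ?] [? ?]], w as [[? ?] [? ?]].
  unfold circle_velocity, circle; rewrite is_derive_C2.
  simpl; unfold plus, scal; simpl; unfold mult; simpl.
  (split; split); derive_real; unfold opp, plus, mult; simpl; unfold opp; simpl; ring.
Qed.

(** The equation [gamma'' = s i gamma' + (s c - 1) gamma] is linear with constant
    coefficients.  Writing [gamma t = e^(i s t / 2) delta t] removes the first
    order term and leaves [delta'' = - omega^2 delta] with
    [omega^2 = 1 - s c + s^2 / 4].  The initial velocity of [delta] is
    [omega w], where [w] turns out to be a unit vector orthogonal to [z], so
    [delta] is a great circle and [gamma] stays on the sphere. *)
Lemma S3_motion_exists (s c : R) (z v : C2) :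
  inner_C2 z z = 1 -> inner_C2 z v = 0 -> inner_C2 v v = 1 ->
  inner_C2 (mul_i z) v = c -> 0 < 1 - s * c + s ^ 2 / 4 ->
  exists gamma gamma' gamma'',
    magnetic_motion (S := S3_magnetic s) (lorentz_S3 s) gamma gamma' gamma'' /\
    (forall t, inner_C2 (mul_i (gamma t)) (gamma' t) = c) /\
    gamma 0 = z /\ gamma' 0 = v.
Proof.
  intros Hz Hzv Hv Hc Hpos.
  pose proof (sqrt_lt_R0 _ Hpos) as Ho; pose proof (sqrt_sqrt _ (Rlt_le _ _ Hpos)) as Hoo.
  set (omega := sqrt (1 - s * c + s ^ 2 / 4)) in *; clearbody omega.
  set (w := scal (/ omega) (minus v (scal (s / 2) (mul_i z : C2))) : C2).
  assert (Hw : inner_C2 w w = 1).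
  { transitivity (/ (omega * omega) * (inner_C2 v v - s * inner_C2 (mul_i z) v
                                      + s ^ 2 / 4 * inner_C2 z z)).
    - unfold w; coords; field; lra.
    - rewrite Hz, Hv, Hc, Hoo; field; lra. }
  assert (Hzw : inner_C2 z w = 0).
  { transitivity (/ omega * inner_C2 z v); [unfold w; coords; field; lra | rewrite Hzv; ring]. }
  assert (Hizw : omega * inner_C2 (mul_i z) w = c - s / 2).
  { transitivity (inner_C2 (mul_i z) v - s / 2 * inner_C2 z z).
    - unfold w; coords; field; lra.
    - rewrite Hz, Hc; ring. }
  set (delta := circle omega z w); set (delta' := circle_velocity omega z w).
  assert (D : is_velocity delta delta') by apply circle_derive.
  assert (D' : is_velocity delta' (fun t => scal (- (omega * omega)) (delta t))).
  { intros t; evar_last.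
    - apply is_derive_scal_vector, circle_derive.
    - unfold circle_velocity, delta, circle; generalize w; intros; coords_eq. }
  assert (P : forall t, Rsqr (sin (omega * t)) + Rsqr (cos (omega * t)) = 1)
    by (intros; apply sin2_cos2).
  assert (N : forall t, inner_C2 (delta t) (delta t) = 1).
  { intros t; rewrite <- (P t).
    transitivity (Rsqr (sin (omega * t)) * inner_C2 w w + Rsqr (cos (omega * t)) * inner_C2 z z
       + 2 * cos (omega * t) * sin (omega * t) * inner_C2 z w).
    - unfold delta, circle, Rsqr; generalize w; intros; coords; ring.
    - rewrite Hw, Hz, Hzw; ring. }
  assert (N' : forall t, inner_C2 (delta' t) (delta' t) = omega * omega).
  { intros t; rewrite <- (Rmult_1_r (omega * omega)), <- (P t).
    transitivity (omega * omega * (Rsqr (sin (omega * t)) * inner_C2 z z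
       + Rsqr (cos (omega * t)) * inner_C2 w w
       - 2 * cos (omega * t) * sin (omega * t) * inner_C2 z w)).
    - unfold delta', circle_velocity, circle, Rsqr; generalize w; intros; coords; ring.
    - rewrite Hw, Hz, Hzw; ring. }
  assert (M : forall t, inner_C2 (mul_i (delta t)) (delta' t) = c - s / 2).
  { intros t; rewrite <- Hizw, <- (Rmult_1_l (omega * _)), <- (P t).
    unfold delta, delta', circle_velocity, circle, Rsqr; generalize w; intros; coords; ring. }
  assert (L : forall t, inner_C2 (mul_i (rotate (s / 2 * t) (delta t)))
     (rotate (s / 2 * t) (plus (delta' t) (scal (s / 2) (mul_i (delta t) : C2)))) = c).
  { intros t; rewrite mul_i_rotate, inner_rotate.
    transitivity (inner_C2 (mul_i (delta t)) (delta' t) + s / 2 * inner_C2 (delta t) (delta t)).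
    - generalize (delta t) (delta' t); intros; coords; field.
    - rewrite M, N; ring. }
  exists (fun t => rotate (s / 2 * t) (delta t)),
    (fun t => rotate (s / 2 * t) (plus (delta' t) (scal (s / 2) (mul_i (delta t) : C2)))),
    (fun t => minus (lorentz_S3 s (rotate (s / 2 * t) (delta t))
        (rotate (s / 2 * t) (plus (delta' t) (scal (s / 2) (mul_i (delta t) : C2)))))
        (scal (/ radius (S3_magnetic s) ^ 2) (rotate (s / 2 * t) (delta t)))).
  split; [refine (conj _ (conj _ (conj _ (conj _ _)))); intros t | split; [exact L | split]].
  - apply rotate_derive, D.
  - evar_last.
    + apply (rotate_derive (s / 2)), (is_derive_plus (V := C2)); [apply D' |].
      apply is_derive_scal_vector, mul_i_derive, D.
    + unfold lorentz_S3; rewrite L, Hoo.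
      generalize (delta t) (delta' t); intros; unfold rotate; simpl radius; coords_eq; field.
  - unfold on_sphere; simpl; rewrite inner_rotate, N; ring.
  - simpl; rewrite inner_rotate.
    transitivity (inner_C2 (delta' t) (delta' t) + s * inner_C2 (mul_i (delta t)) (delta' t)
       + s ^ 2 / 4 * inner_C2 (delta t) (delta t)).
    + generalize (delta t) (delta' t); intros; coords; field.
    + rewrite N, N', M, Hoo; field.
  - reflexivity.
  - simpl; rewrite Rmult_0_r, rotate_0; unfold delta, circle.
    rewrite Rmult_0_r, cos_0, sin_0; generalize w; intros; coords_eq.
  - simpl; rewrite Rmult_0_r, rotate_0; unfold delta, delta', circle_velocity, circle.
    rewrite Rmult_0_r, cos_0, sin_0; unfold w; coords_eq; field; lra.
Qed.

(** * The covering *)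

(** A preimage with real positive first coordinate exists away from the south
    pole [(0, - 1/2)], which is the image of [(0, 1)]. *)
Lemma hopf_surjective (x : CxR) :
  inner_CxR x x = (1 / 2) ^ 2 -> exists z, inner_C2 z z = 1 /\ hopf z = x.
Proof.
  destruct x as [[a b] h]; unfold inner_CxR; simpl; intros H.
  destruct (Req_dec h (- / 2)) as [-> | Hh].
  - assert (a = 0) as -> by nra; assert (b = 0) as -> by nra.
    exists ((0, 0), (1, 0)); rewrite hopf_dhopf; unfold dhopf; split.
    + coords; ring.
    + coords_eq; field.
  - assert (Hp : 0 < / 2 + h) by nra.
    pose proof (sqrt_lt_R0 _ Hp) as Hm; pose proof (sqrt_sqrt _ (Rlt_le _ _ Hp)) as Hmm.
    set (m := sqrt (/ 2 + h)) in *; clearbody m.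
    assert (Hab : a * a + b * b = m * m * (1 - m * m)) by nra.
    exists ((m, 0), (a / m, b / m)); rewrite hopf_dhopf; unfold dhopf; split.
    + coords.
      transitivity (m * m + (a * a + b * b) / (m * m)); [field; lra | rewrite Hab; field; lra].
    + coords_eq; try (field; lra).
      transitivity (/ 2 * (m * m - (a * a + b * b) / (m * m)));
        [field; lra | rewrite Hab; field_simplify; lra].
Qed.

(** By the intermediate value theorem: [s - 2 cos x - r sin x] equals [s - 2 < 0]
    at [x = 0] and [s + 2 > 0] at [x = PI]. *)
Lemma contact_angle_exists (s r : R) :
  0 <= s < 2 -> exists psi, 0 < psi < PI /\ r * sin psi = s - 2 * cos psi.
Proof.
  intros hs.
  set (f := fun x => s - 2 * cos x - r * sin x).
  assert (Cf : continuity f) by (unfold f; reg).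
  assert (F0 : f 0 = s - 2) by (unfold f; rewrite cos_0, sin_0; ring).
  assert (FPI : f PI = s + 2) by (unfold f; rewrite cos_PI, sin_PI; ring).
  destruct (IVT f 0 PI Cf PI_RGT_0) as [psi [[Hl Hu] E]]; [lra | lra |].
  exists psi; repeat split.
  - destruct Hl as [| <-]; [assumption | lra].
  - destruct Hu as [| ->]; [assumption | lra].
  - unfold f in E; lra.
Qed.

Lemma op_reparametrization_scale {V : Type} (c : R -> V) (k : R) :
  0 < k -> op_reparametrization c (fun t => c (k * t)).
Proof.
  intros Hk; exists (fun t => k * t); repeat split.
  - intros n t; apply ex_derive_n_scal_l.
    apply ex_derive_n_ext with (f := fun x => x ^ 1); [intros; ring | apply ex_derive_n_pow].
  - intros t; replace (Derive _ _) with k; trivial.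
    symmetry; apply is_derive_unique; auto_derive; trivial; ring.
  - intros y; exists (y / k); field; lra.
Qed.

(** Adding the vertical vector [cos psi * iz] to the horizontal lift of
    [sin psi * u] gives the initial velocity of contact angle [psi]. *)
Lemma contact_velocity_exists (z : C2) (u : CxR) (psi : R) :
  inner_C2 z z = 1 -> inner_CxR (hopf z) u = 0 -> inner_CxR u u = 1 ->
  exists v, inner_C2 z v = 0 /\ inner_C2 v v = 1 /\
    inner_C2 (mul_i z) v = cos psi /\ dhopf z v = scal (sin psi) u.
Proof.
  intros Hz T Hu.
  pose proof (sin2_cos2 psi) as Hsc; unfold Rsqr in Hsc.
  assert (Hi : dhopf z (mul_i z) = zero) by (clear; unfold dhopf; coords_eq).
  set (w := dhopf_adjoint z u).
  assert (Wz : inner_C2 w z = 0).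
  { unfold w; rewrite dhopf_adjointP.
    transitivity (2 * inner_CxR (hopf z) u); [| rewrite T; ring].
    rewrite hopf_dhopf; generalize (dhopf z z); intros; coords; field. }
  assert (Wi : inner_C2 w (mul_i z) = 0)
    by (unfold w; rewrite dhopf_adjointP, Hi; coords; ring).
  assert (Ww : inner_C2 w w = 1)
    by (unfold w; rewrite dhopf_adjoint_norm, Hz, Hu; ring).
  exists (plus (scal (cos psi) (mul_i z : C2)) (scal (sin psi) w)).
  repeat split.
  - transitivity (sin psi * inner_C2 w z); [| rewrite Wz; ring].
    generalize w; intros; coords; ring.
  - transitivity (cos psi * cos psi * inner_C2 z z + sin psi * sin psi * inner_C2 w w
          + 2 * cos psi * sin psi * inner_C2 w (mul_i z)).
    + generalize w; intros; coords; ring.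
    + rewrite Hz, Ww, Wi; lra.
  - transitivity (cos psi * inner_C2 z z + sin psi * inner_C2 w (mul_i z)).
    + generalize w; intros; coords; ring.
    + rewrite Hz, Wi; ring.
  - transitivity (plus (scal (cos psi) (dhopf z (mul_i z))) (scal (sin psi) (dhopf z w))).
    + generalize w; clear; hopf_coords.
    + unfold w; rewrite dhopf_dhopf_adjoint, Hi, Hz; clear; coords_eq.
Qed.

(** The speed of [hopf o gamma] is [sin psi], so that of the reparametrized
    curve is [phi' sin psi]. *)
Lemma unit_speed_reparametrization_rate (s r psi : R) gamma gamma' gamma''
    (phi : R -> R) (eta : R -> CxR) :
  0 < sin psi ->
  magnetic_motion (S := S3_magnetic s) (lorentz_S3 s) gamma gamma' gamma'' ->
  (forall t, inner_C2 (mul_i (gamma t)) (gamma' t) = cos psi) ->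
  (forall t, ex_derive phi t) -> (forall t, 0 < Derive phi t) ->
  (forall t, eta t = hopf (gamma (phi t))) -> unit_speed (S2_magnetic r) eta ->
  forall t, is_derive phi t (/ sin psi).
Proof.
  intros Hsin (V & _ & Hs & Hu & _) L Dphi Pphi Heta (eta' & Ve & Ne) t.
  replace (/ sin psi) with (Derive phi t); [apply Derive_correct, Dphi |].
  assert (E : eta' t = scal (Derive phi t) (dhopf (gamma (phi t)) (gamma' (phi t)))).
  { apply (velocity_unique (euclidean_S2 r) eta eta'
      (fun t => scal (Derive phi t) (dhopf (gamma (phi t)) (gamma' (phi t)))) Ve).
    intros x; apply is_derive_ext with (f := fun t => hopf (gamma (phi t))).
    - intros y; now rewrite Heta.
    - apply (is_derive_comp_constant_rate (fun x => hopf (gamma x))).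
      + apply hopf_derive, V.
      + apply Derive_correct, Dphi. }
  specialize (Ne t); rewrite E in Ne; simpl in Ne.
  specialize (Pphi t); set (k := Derive phi t) in *; clearbody k.
  assert (Q : (k * sin psi) ^ 2 = 1).
  { rewrite <- Ne.
    transitivity (k * k * inner_CxR (dhopf (gamma (phi t)) (gamma' (phi t)))
                (dhopf (gamma (phi t)) (gamma' (phi t)))).
    - specialize (Hs (phi t)); specialize (Hu (phi t)).
      unfold on_sphere in Hs; simpl in Hs, Hu.
      rewrite norm_dhopf, Hs, Hu, L; simpl.
      pose proof (sin2_cos2 psi) as Hsc; unfold Rsqr in Hsc.
      replace (1 * (1 * 1) * 1 - cos psi * (cos psi * 1)) with (sin psi * sin psi) by lra.
      ring.
    - generalize (dhopf (gamma (phi t)) (gamma' (phi t))); intros; coords; ring. }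
  assert (k * sin psi = 1) by (pose proof (Rmult_lt_0_compat _ _ Pphi Hsin); nra).
  apply (Rmult_eq_reg_r (sin psi)); [rewrite H; field; lra | lra].
Qed.

Theorem corollary1p14 (s : R) (hs : 0 <= s < 2) :
  forall r : R, exists psi : R, 0 < psi < PI /\
    forall eta : R -> CxR,
      (magnetic_geodesic (S2_magnetic r) eta /\ unit_speed (S2_magnetic r) eta) <->
      (exists gamma : R -> C2,
         magnetic_geodesic (S3_magnetic s) gamma /\
         unit_speed (S3_magnetic s) gamma /\
         has_contact_angle gamma psi /\
         op_reparametrization (fun t : R => hopf (gamma t)) eta /\
         unit_speed (S2_magnetic r) eta).
Proof.
  intros r.
  destruct (contact_angle_exists s r hs) as (psi & Hpsi & Er).
  exists psi; split; trivial; intros eta.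
  pose proof (sin_gt_0 psi (proj1 Hpsi) (proj2 Hpsi)) as Hsin.
  pose proof (sin2_cos2 psi) as Hsc; unfold Rsqr in Hsc.
  pose proof (Rinv_0_lt_compat _ Hsin) as Hk0.
  assert (Hk : (/ sin psi) ^ 2 * (1 - cos psi ^ 2) = 1).
  { replace (1 - cos psi ^ 2) with (sin psi * sin psi) by lra; field; lra. }
  assert (Hr : r = / sin psi * (s - 2 * cos psi)) by (rewrite <- Er; field; lra).
  assert (geodesic3 := fun gamma => unit_speed_magnetic_geodesic_iff (euclidean_S3 s)
            (lorentz_S3 s) gamma R1_neq_R0 (lorentz_force_S3 s)).
  assert (half : 1 / 2 <> 0) by lra.
  assert (geodesic2 := fun eta => unit_speed_magnetic_geodesic_iff (euclidean_S2 r)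
            (lorentz_S2 r) eta half (lorentz_force_S2 r)).
  split.
  - intros H; pose proof H as [_ US].
    apply geodesic2 in H as (eta' & eta'' & H).
    pose proof H as (V & V' & Hs & Hu & _).
    pose proof (sphere_velocity_tangent (euclidean_S2 r) eta eta' V Hs 0) as T.
    destruct (hopf_surjective (eta 0) (Hs 0)) as (z & Hz & Ez).
    unfold tangent in T; simpl in T; rewrite <- Ez in T.
    destruct (contact_velocity_exists z (eta' 0) psi Hz T (Hu 0)) as (v & Hzv & Hv & Hc & Dv).
    destruct (S3_motion_exists s (cos psi) z v) as
      (gamma & gamma' & gamma'' & G & L & G0 & G0'); trivial.
    (* The frequency is positive: [1 - s c + s^2 / 4 = (1 - c^2) + (s / 2 - c)^2]. *)
    { replace (1 - s * cos psi + s ^ 2 / 4)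
        with (sin psi * sin psi + Rsqr (s / 2 - cos psi)) by (unfold Rsqr; lra).
      pose proof (Rle_0_sqr (s / 2 - cos psi)); nra. }
    exists gamma.
    destruct (proj2 (geodesic3 gamma)) as [G3 G3']; [now exists gamma', gamma'' |].
    refine (conj G3 (conj G3' (conj _ (conj _ US)))).
    + split; [lra |]; exists gamma'; split; [apply G |].
      intros t; symmetry; apply L.
    + destruct (op_reparametrization_scale (fun t => hopf (gamma t)) _ Hk0)
        as (phi & P1 & P2 & P3 & P4).
      exists phi; refine (conj P1 (conj P2 (conj P3 _))); intros t.
      rewrite <- P4.
      destruct (hopf_motion s r (cos psi) (/ sin psi) gamma gamma' gamma''
                  (fun t => / sin psi * t)) as (zeta'' & Z); trivial.
      { intros x; auto_derive; trivial; ring. }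
      apply (S2_motion_unique _ _ _ _ _ _ _ H Z).
      * now rewrite Rmult_0_r, G0.
      * rewrite Rmult_0_r, G0, G0', Dv; generalize (eta' 0); intros; coords_eq; field; lra.
  - intros (gamma & G & US & (_ & gamma1 & V1 & L) & (phi & P1 & P2 & _ & P4) & US2).
    split; trivial.
    destruct (proj1 (geodesic3 gamma) (conj G US)) as (gamma' & gamma'' & M).
    assert (L' : forall t, inner_C2 (mul_i (gamma t)) (gamma' t) = cos psi).
    { intros t; rewrite (L t); f_equal.
      apply (velocity_unique (euclidean_S3 s) gamma); trivial; apply M. }
    pose proof (unit_speed_reparametrization_rate s r psi gamma gamma' gamma'' phi eta
                  Hsin M L' (P1 1%nat) P2 P4 US2) as Dphi.
    destruct (hopf_motion s r (cos psi) (/ sin psi) gamma gamma' gamma'' phi M L' Hk Hr Dphi)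
      as (zeta'' & Z).
    apply magnetic_geodesic_ext with (c := fun t => hopf (gamma (phi t))).
    + intros t; symmetry; apply P4.
    + apply geodesic2; eauto.
Qed.
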